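(* Let $R$ be a Rickart *-ring with proper involution. The following conditions on elements $a,b\in R$ are equivalent: (a) $a$ and $b$ are coherent, i.e. $a^*b=b^*a$ and $ab''=ba''$; (b) $a$ and $b$ have a common upper bound in $(R,\preceq)$, $a''\in K_b$ and $b''\in K_a$; (c) $a\curlyvee b$ exists, and $a+ba'=a\curlyvee b=b+ab'$; (d) $a\curlywedge b$ and $a\curlyvee b$ exist, and $ab''=a\curlywedge b=ba''$ and $a\curlyvee b=ab'+(a\curlywedge b)+ba'$ $\bigl(=a+b-(a\curlywedge b)\bigr)$.
   Context: A *-ring is an associative ring $R$ with an involution $x\mapsto x^*$ (additive, $(xy)^*=y^*x^*$, $x^{**}=x$). A projection is an element $e$ with $e^2=e=e^*$; $P$ denotes the set of projections of $R$. $R$ is a Rickart *-ring if the right annihilator of every element is generated by a projection, i.e. to each $x\in R$ there is a (necessarily unique) projection $x'$ such that for all $y\in R$: $xy=0$ iff $y=x'y$. Then $R$ has the unit $1:=0'$, and $e'=1-e$ for $e\in P$. Write $x'':=(x')'$. For $x\in R$, $K_x:=\{e\in P: e\,x^*x=x^*x\,e\}$. Elements $x,y$ are *-orthogonal, $x\perp y$, if $xy^*=0=x^*y$. The involution is proper if $x^*x=0$ implies $x=0$. The star order on $R$ is the partial order defined by: $x\preceq y$ iff $x\perp y-x$; equivalently, $x^*x=x^*y$ and $xx^*=yx^*$. The symbols $\curlyvee$ and $\curlywedge$ denote the (in general partial) join and meet (least upper and greatest lower bound of two elements) in $(R,\preceq)$. *)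

(* Defs.v *)
From HB Require Import structures.
From mathcomp Require Import all_boot ssralg.

Set Implicit Arguments.
Unset Strict Implicit.
Unset Printing Implicit Defensive.

Import GRing.Theory.
Local Open Scope ring_scope.

HB.mixin Record PzRing_isStarRing R of GRing.PzRing R := {
  star : R -> R;
  starD : forall x y : R, star (x + y) = star x + star y;
  starM : forall x y : R, star (x * y) = star y * star x;
  starK : forall x : R, star (star x) = x
}.

#[short(type="starRingType")]
HB.structure Definition StarRing := { R of PzRing_isStarRing R & GRing.PzRing R }.

Notation "x ^*" := (star x) : ring_scope.

Definition is_projection (R : starRingType) (e : R) : Prop :=
  e * e = e /\ e^* = e.

(* The operation [rann], written x^' below, is uniquely determined by its
   axioms: two projections generating the same right ideal are equal.
   It is not required that the ring be nontrivial; the unit of the ring is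
   necessarily 0^'. *)
HB.mixin Record StarRing_isRickart R of StarRing R := {
  rann : R -> R;
  rann_projection : forall x : R, is_projection (rann x);
  rannP : forall x y : R, x * y = 0 <-> y = rann x * y
}.

#[short(type="rickartStarRingType")]
HB.structure Definition RickartStarRing :=
  { R of StarRing_isRickart R & StarRing R }.

Notation "x ^'" := (rann x) : ring_scope.
Notation "x ^''" := (rann (rann x)) (at level 1, format "x ^''") : ring_scope.

Section StarOrder.
Variable R : starRingType.
Implicit Types x y z e : R.

Definition proper_involution : Prop := forall x, x^* * x = 0 -> x = 0.

(* in_K x e : the element e belongs to the set K_x. *)
Definition in_K x e : Prop :=
  is_projection e /\ e * (x^* * x) = (x^* * x) * e.

Definition star_orth x y : Prop := x * y^* = 0 /\ x^* * y = 0.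

Definition star_le x y : Prop := star_orth x (y - x).

Definition star_ub x y z : Prop := star_le x z /\ star_le y z.

Definition star_lb x y z : Prop := star_le z x /\ star_le z y.

Definition is_star_join x y j : Prop :=
  star_ub x y j /\ forall z, star_ub x y z -> star_le j z.

Definition is_star_meet x y m : Prop :=
  star_lb x y m /\ forall z, star_lb x y z -> star_le z m.

End StarOrder.

Arguments proper_involution R : clear implicits.

Definition coherent (R : rickartStarRingType) (x y : R) : Prop :=
  x^* * y = y^* * x /\ x * y^'' = y * x^''.

(* Main.v *)
Require Import Defs.
From mathcomp Require Import all_boot ssralg.

Set Implicit Arguments.
Unset Strict Implicit.
Unset Printing Implicit Defensive.

Import GRing.Theory.
Local Open Scope ring_scope.

(** A common upper bound z of a and b gives a = z a'' and b = z b'', so once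
    a'' and b'' commute both a b'' and b a'' equal z a'' b''. Coherence says
    precisely that a + b a' = b + a b' and that this element is an upper bound
    of a and b; the commutation of a'' with b* b (hence with b'') and of b''
    with a* a then makes it the least upper bound, and makes a b'' = b a'' the
    greatest lower bound. *)

Section StarRing.
Variable R : starRingType.
Implicit Types x y e : R.

Lemma star0 : (0 : R)^* = 0.
Proof. by apply: (@addrI R (0^*)); rewrite -starD !addr0. Qed.

Lemma starN x : (- x)^* = - x^*.
Proof. by apply: (@addrI R (x^*)); rewrite -starD !subrr star0. Qed.

Lemma starB x y : (x - y)^* = x^* - y^*.
Proof. by rewrite starD starN. Qed.

Lemma star_leE x y : star_le x y <-> x^* * y = x^* * x /\ y * x^* = x * x^*.
Proof.
rewrite /star_le /star_orth mulrBr starB mulrBr; split=> [[h1 h2]|[h1 h2]].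
  split; first exact/subr0_eq.
  by rewrite -[LHS]starK starM starK (subr0_eq h1) starM starK.
split; last by rewrite h1 subrr.
by rewrite -[x * y^*]starK starM starK h2 starM starK subrr.
Qed.

Lemma star_le_starMl x y : star_le x y -> y^* * x = x^* * x.
Proof. by case/star_leE => h _; rewrite -[LHS]starK starM starK h starM starK. Qed.

(** Cutting [x] down by a projection that commutes with [x^* * x] goes down in the order. Applied to
    both [a * b^''] and [b * a^''], this gives the lower bound half of the meet. *)
Lemma in_K_le x e : in_K x e -> star_le (x * e) x.
Proof.
move=> [[ee es] ke]; apply/star_leE; rewrite starM es.
split; last by rewrite -!mulrA (mulrA e e) ee.
by rewrite -!mulrA (mulrA _ x e) -ke (mulrA e e) ee.
Qed.

End StarRing.

Section Rickart.
Variable R : rickartStarRingType.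
Implicit Types a b c e x y z : R.

Lemma rann_idem x : x^' * x^' = x^'. Proof. by case: (rann_projection x). Qed.
Lemma star_rann x : x^'^* = x^'. Proof. by case: (rann_projection x). Qed.

Lemma mulr_rann x : x * x^' = 0.
Proof. by apply/rannP; rewrite rann_idem. Qed.

Lemma rann_mul_rann2 x : x^' * x^'' = 0. Proof. exact: mulr_rann. Qed.

Lemma rann2E x : x^'' = 1 - x^'.
Proof.
have /rannP : x^' * (1 - x^') = 0 by rewrite mulrBr mulr1 rann_idem subrr.
have: x^'' * x^' = 0.
  by rewrite -[LHS]starK starM !star_rann mulr_rann star0.
by move=> h; rewrite mulrBr h subr0 mulr1 => ->.
Qed.

Lemma rannE x : x^' = 1 - x^''.
Proof. by rewrite rann2E opprB addrC subrK. Qed.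

Lemma mulr_rann2 x : x * x^'' = x.
Proof. by rewrite rann2E mulrBr mulr1 mulr_rann subr0. Qed.

Lemma rann2_mul_star x : x^'' * x^* = x^*.
Proof. by rewrite -{1}(star_rann (rann x)) -starM mulr_rann2. Qed.

(** Orthogonality puts [(y - x)^*] in the right annihilator of [x], so [y - x] is fixed by [x^'] on
    the right and killed by [x^'']. *)
Lemma star_le_mulr_rann2 x y : star_le x y -> y * x^'' = x.
Proof.
case=> /rannP h _.
have: (y - x) * x^'' = 0.
  by rewrite rann2E mulrBr mulr1 -{1}[y - x]starK h starM starK star_rann subrr.
by rewrite mulrBl mulr_rann2 => /subr0_eq.
Qed.

Hypothesis R_proper : proper_involution R.

Lemma star_mul_eq0 x y : x^* * x * y = 0 -> x * y = 0.
Proof.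
by move=> h; apply: R_proper; rewrite starM -!mulrA (mulrA _ x y) h mulr0.
Qed.

(** By properness, [e] maps the right annihilator of [x] into itself, so [e * x^' = x^' * e * x^'].
    The right side is self-adjoint, hence so is the left. *)
Lemma in_K_comm_rann x e : in_K x e -> e * x^' = x^' * e.
Proof.
move=> [[_ es] ke].
have /rannP h : x * (e * x^') = 0.
  by apply: star_mul_eq0; rewrite mulrA -ke -!mulrA mulr_rann !mulr0.
have hs : x^' * e = x^' * (e * x^').
  by rewrite -[LHS]starK starM es star_rann [in LHS]h !starM es !star_rann mulrA.
by rewrite h hs.
Qed.

Lemma in_K_comm_rann2 x e : in_K x e -> e * x^'' = x^'' * e.
Proof.
by move=> /in_K_comm_rann h; rewrite rann2E mulrBl mulrBr mulr1 mul1r h.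
Qed.

Lemma coherent_sym a b : coherent a b -> coherent b a.
Proof. by case. Qed.

(** Replacing [b * a^''] by [a * b^''] and using [a^* * b = b^* * a], both products reduce to
    [b^* * a]. *)
Lemma coherent_in_K a b : coherent a b -> in_K b a^''.
Proof.
move=> [ab e]; split; first exact: rann_projection.
have -> : a^'' * (b^* * b) = b^* * a.
  rewrite mulrA -{1}(star_rann (rann a)) -starM -e starM star_rann.
  by rewrite -mulrA ab mulrA rann2_mul_star.
by rewrite -mulrA -e mulrA -ab -mulrA mulr_rann2.
Qed.

Lemma rann_join_swap a b :
  a * b^'' = b * a^'' <-> a + b * a^' = b + a * b^'.
Proof.
rewrite !rann2E !mulrBr !mulr1.
have e : (a - a * b^' == b - b * a^') = (a + b * a^' == b + a * b^').
  by rewrite subr_eq addrAC eq_sym subr_eq eq_sym.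
by split=> /eqP h; apply/eqP; move: h; rewrite e.
Qed.

Lemma coherent_le_join a b : coherent a b -> star_le a (a + b * a^').
Proof.
move=> [ab e]; apply/star_leE.
rewrite mulrDr mulrA ab -mulrA mulr_rann mulr0 addr0; split=> //.
rewrite mulrDl -(rann2_mul_star a) -!mulrA (mulrA _^' _^'') rann_mul_rann2.
by rewrite mul0r mulr0 addr0.
Qed.

Lemma coherent_join a b : coherent a b -> is_star_join a b (a + b * a^').
Proof.
move=> ab; have ka := coherent_in_K ab.
have lea := coherent_le_join ab.
have leb : star_le b (a + b * a^').
  by rewrite ((rann_join_swap a b).1 ab.2); apply/coherent_le_join/coherent_sym.
split=> // z [az bz]; apply/star_leE.
have [az1 az2] := (star_leE _ _).1 az; have [bz1 bz2] := (star_leE _ _).1 bz.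
have kb : a^' * (b^* * b) = b^* * b * a^'.
  by rewrite rannE mulrBl mulrBr mul1r mulr1 ka.2.
have cb : a^' * b^'' = b^'' * a^'.
  by rewrite rannE mulrBl mulrBr mul1r mulr1 (in_K_comm_rann2 ka).
set c := a + b * a^' in lea leb *; split.
  (* Both [c^* * z] and [c^* * c] equal [a^* * a + b^* * b * a^']. *)
  rewrite {3}/c mulrDr mulrA (star_le_starMl lea) (star_le_starMl leb).
  by rewrite /c starD starM star_rann mulrDl -!mulrA az1 bz1 kb mulrA.
have ca : c * a^' = b * a^'.
  by rewrite /c mulrDl mulr_rann add0r -mulrA rann_idem.
(* Write [b^*] as [b^'' * b^*], move [b^''] past [a^'], and absorb it by [z * b^'' = b]. *)
have zb : z * a^' * b^* = b * a^' * b^*.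
  by rewrite -{1}(rann2_mul_star b) !mulrA -(mulrA z) cb mulrA star_le_mulr_rann2.
have [_ ca2] := (star_leE _ _).1 lea.
have -> : c^* = a^* + a^' * b^* by rewrite /c starD starM star_rann.
by rewrite !mulrDr ca2 az2 !mulrA zb ca.
Qed.

Lemma coherent_meet a b : coherent a b -> is_star_meet a b (a * b^'').
Proof.
move=> ab; split.
  split; first exact/in_K_le/coherent_in_K/coherent_sym.
  by rewrite ab.2; apply/in_K_le/coherent_in_K.
move=> z [/star_leE[za1 za2] /star_leE[zb1 zb2]].
(* Below [b], [z^* * z * b^' = z^* * b * b^' = 0]; properness removes the factor [z^*]. *)
have zb : z * b^'' = z.
  rewrite rann2E mulrBr mulr1 (@star_mul_eq0 z) ?subr0 //.
  by rewrite -zb1 -mulrA mulr_rann mulr0.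
apply/star_leE; split; first by rewrite mulrA za1 -mulrA zb.
by rewrite -mulrA -(star_rann (rann b)) -starM zb.
Qed.

(** The adjoint condition comes from the chain [a^* * b = a^* * c * b^'' = a^* * a * b^'' = b^'' *
    a^* * a = b^'' * c^* * a = b^* * a]. *)
Lemma coherent_of_ub a b c :
  star_ub a b c -> in_K b a^'' -> in_K a b^'' -> coherent a b.
Proof.
move=> [ac bc] ka kb.
have ea := star_le_mulr_rann2 ac; have eb := star_le_mulr_rann2 bc; split.
  rewrite -{1}eb mulrA ((star_leE _ _).1 ac).1 -kb.2.
  by rewrite -{2}eb starM star_rann -mulrA (star_le_starMl ac).
by rewrite -{1}ea -{2}eb -!mulrA (in_K_comm_rann2 ka).
Qed.

Lemma le_join_star_mul a b :
  star_le a (a + b * a^') -> a^* * b = a^* * b * a^''.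
Proof.
case/star_leE => h _; move: h; rewrite mulrDr mulrA -[RHS]addr0 => /addrI h.
by rewrite rann2E mulrBr mulr1 h subr0.
Qed.

(* The upper bound property gives b* a = b'' (a* a) = b'' (a* a) b'', whose
   right-hand side is self-adjoint. *)
Lemma coherent_of_ub_join a b :
  star_ub a b (a + b * a^') -> a + b * a^' = b + a * b^' -> coherent a b.
Proof.
move=> [lea leb] e; have ab := (rann_join_swap a b).2 e; split=> //.
have ha := le_join_star_mul lea.
rewrite e in leb; have hb := le_join_star_mul leb.
rewrite -mulrA -ab in ha.
have hs : b^* * a = b^'' * (a^* * a).
  by rewrite -[LHS]starK starM starK ha !starM star_rann starK mulrA.
have -> : a^* * b = (b^* * a)^* by rewrite starM starK.
by rewrite hb hs !starM starK star_rann !mulrA.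
Qed.

End Rickart.

Unset Implicit Arguments.

Theorem theorem4p5 (R : rickartStarRingType) (R_proper : proper_involution R)
    (a b : R) :
  [<-> coherent a b;
       (exists c : R, star_ub a b c) /\ in_K b a^'' /\ in_K a b^'';
       exists j : R, is_star_join a b j /\ a + b * a^' = j /\ j = b + a * b^';
       exists m j : R,
         is_star_meet a b m /\ is_star_join a b j /\
         a * b^'' = m /\ m = b * a^'' /\
         j = a * b^' + m + b * a^' /\ a * b^' + m + b * a^' = a + b - m].
Proof.
(* With [m = a * b^''], this collapses the three-term formula for the join in the last condition to
   [a + b * a^']. *)
have ea : a * b^' + a * b^'' = a.
  by rewrite -mulrDr (rann2E b) addrC subrK mulr1.
tfae.
- move=> ab; split.
    by exists (a + b * a^'); case: (coherent_join R_proper ab).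
  by split; apply: coherent_in_K => //; apply: coherent_sym.
- move=> [[c ub] [ka kb]].
  have ab := coherent_of_ub R_proper ub ka kb.
  exists (a + b * a^'); split; first exact: coherent_join.
  by split=> //; apply/rann_join_swap; case: ab.
- move=> [j [[ub h] [ej e]]]; subst j.
  have ab := coherent_of_ub_join ub e.
  exists (a * b^''), (a + b * a^'); split; first exact: coherent_meet.
  do 2!split=> //; split; first exact: ab.2.
  rewrite ea; split=> //.
  by rewrite ab.2 -addrA -[X in X - _]mulr1 -mulrBr (rann2E a) subKr.
- move=> [m [j [_ [[ub _] [em [em' [ej _]]]]]]].
  rewrite -em ea in ej; subst j.
  by apply: coherent_of_ub_join => //; apply/rann_join_swap; rewrite em.
Qed.
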